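(* Let $m\in\mathbb N+1$, $n\in\mathbb N^m\setminus\{1_m\}$, and let $M\in\mathbb N_0^n$ be a principal reversible cuboid. Then there are $j\in\{1,\dots,m\}$ and $\tilde n\in\mathbb N^m$ such that $\tilde n_i=n_i$ for $i\ne j$, $\tilde n_j<n_j$, $\tilde n_j\mid n_j$, and $M_{[\tilde n]}$ is a principal reversible subcuboid of $M$. Moreover, for any $\hat n\le\tilde n$ and any $k\in\langle n_j/\tilde n_j\rangle$, \[M_{\hat n+k\tilde n_je_j}=M_{\hat n}+k\prod_{i=1}^m\tilde n_i.\]
   Context: $\mathbb N=\{1,2,\dots\}$, $\mathbb N_0=\mathbb N\cup\{0\}$, $\mathbb N+1=\{2,3,\dots\}$, $\langle N\rangle=\{0,\dots,N-1\}$. For $n\in\mathbb N^m$, a cuboid $M\in\mathbb N_0^n$ has entries $M_k\in\mathbb N_0$ for $k\in\mathbb N^m$, $k\le n$ componentwise; $1_m=(1,\dots,1)$, $e_j$ the $j$-th unit vector. Property (V): for all $1\le i<j\le m$ and all index vectors in range, $M_{k_1,\dots,k_i,\dots,k_j,\dots,k_m}+M_{k_1,\dots,k_i',\dots,k_j',\dots,k_m}=M_{k_1,\dots,k_i,\dots,k_j',\dots,k_m}+M_{k_1,\dots,k_i',\dots,k_j,\dots,k_m}$. $M$ is a principal reversible cuboid if it has (V), its set of entries is $\langle\prod_jn_j\rangle$, and $M_k<M_{k+le_j}$ whenever $1\le l\le n_j-k_j$ (dimensions equal to 1 allowed). For $\tilde n\le n$, $M_{[\tilde n]}=(M_k)_{k\le\tilde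 n}$; it is a principal reversible subcuboid if it is itself a principal reversible cuboid. *)

(* Defs.v *)
From mathcomp Require Export all_boot.
Set Implicit Arguments.
Unset Strict Implicit.
Unset Printing Implicit Defensive.

(* Vectors are indexed by 'I_m, i.e. the coordinates j = 1..m are renumbered
   0..m-1; the entries k_j of an index vector are kept 1-based. *)
Definition mvec (m : nat) := {ffun 'I_m -> nat}.

(* k \in N^m, with N = {1, 2, ...} *)
Definition positive_mvec (m : nat) (k : mvec m) : Prop := forall i, 0 < k i.

Definition le_mvec (m : nat) (k n : mvec m) : Prop := forall i, k i <= n i.

Definition in_range (m : nat) (n k : mvec m) : Prop :=
  positive_mvec k /\ le_mvec k n.

Definition ones (m : nat) : mvec m := [ffun=> 1].

(* k + l e_j *)
Definition add_unit (m : nat) (k : mvec m) (l : nat) (j : 'I_m) : mvec m :=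
  [ffun i => if i == j then k i + l else k i].

(* k with its i-th coordinate replaced by a *)
Definition subst_coord (m : nat) (k : mvec m) (i : 'I_m) (a : nat) : mvec m :=
  [ffun x => if x == i then a else k x].

(* A cuboid of dimensions n is given by a total function on index vectors of
   which only the entries M k with in_range n k are meaningful: every notion
   below, taken at dimensions n, inspects M on that range only. Accordingly
   the restriction (M_k)_{k <= nt} is M itself, taken at dimensions nt. *)
Definition cuboid (m : nat) := mvec m -> nat.

Definition property_V (m : nat) (n : mvec m) (M : cuboid m) : Prop :=
  forall (i j : 'I_m) (k : mvec m) (ki' kj' : nat),
    i < j -> in_range n k -> 0 < ki' <= n i -> 0 < kj' <= n j ->
    M k + M (subst_coord (subst_coord k i ki') j kj')
    = M (subst_coord k j kj') + M (subst_coord k i ki').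

Definition principal_reversible (m : nat) (n : mvec m) (M : cuboid m) : Prop :=
  [/\ property_V n M,
      forall v : nat,
        (exists2 k, in_range n k & M k = v) <-> v < \prod_(i < m) n i
    & forall (k : mvec m) (j : 'I_m) (l : nat),
        in_range n k -> 1 <= l <= n j - k j -> M k < M (add_unit k l j)].

Definition principal_reversible_subcuboid
    (m : nat) (n : mvec m) (M : cuboid m) (nt : mvec m) : Prop :=
  le_mvec nt n /\ principal_reversible nt M.

(* Main.v *)
Require Import Defs.
From mathcomp Require Import all_boot zify.

Set Implicit Arguments.
Unset Strict Implicit.
Unset Printing Implicit Defensive.

(** Property (V) makes [M] additive, [M k = \sum_i f_i (k i)], so the images
    [A_i] of the [f_i] form a direct sum decomposition of [{0, ..., N - 1}],
    [N] being the product of the dimensions.  Say [1 \in A_j] and let [b] be the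
    least positive element of the other [A_i].  Then [A_j] is a union of blocks
    [{q b, ..., q b + b - 1}] and the other [A_i] consist of multiples of [b]
    (de Bruijn), so dividing by [b] gives a smaller decomposition; if there is no such [b],
    then [A_j] is the whole interval.  By induction some [A_j] is periodic below
    [N] with a period [P < N] dividing [N], and the truncated cuboid keeps in
    direction [j] the elements of [A_j] that are below [P]. *)

(** * Two-summand decompositions of an interval (de Bruijn) *)

Section TwoSummands.

Variables (N : nat) (A : pred nat) (B : nat -> Prop) (b : nat).
Hypotheses (A0 : A 0) (B0 : B 0).
Hypothesis AB_lt : forall a c, A a -> B c -> a + c < N.
Hypothesis AB_onto : forall v, v < N -> exists a c, [/\ A a, B c & a + c = v].
Hypothesis AB_uniq : forall a c a' c',
  A a -> B c -> A a' -> B c' -> a + c = a' + c' -> c = c'.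
Hypotheses (b_gt0 : 0 < b) (Bb : B b).
Hypothesis b_min : forall c, B c -> 0 < c -> b <= c.

Lemma interval_sub_left y : y < b -> A y.
Proof.
move=> yb; have bN := AB_lt A0 Bb.
have [|a [c [Aa Bc ac]]] := @AB_onto y; first lia.
have c0 : c = 0 by have := b_min Bc; lia.
by have -> : y = a by lia.
Qed.

(** Strong induction on the block index [q]. If [q * b] is in [A], an element of [B] inside the
    block would give a second representation of [q * b + b], and a gap of [A] there a second one of
    [q * b]. If [q * b < N] is not in [A], then [q * b = a + c] with [c > 0], and the block of [A]
    at [a], translated by [c], already represents the whole block at [q * b]. *)
Lemma block_structure q :
  (forall r, r < b -> A (q * b + r) = A (q * b)) /\
  (forall r, 0 < r < b -> ~ B (q * b + r)).
Proof.
elim/ltn_ind: q => q IH.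
have IHA p r : p < q -> r < b -> A (p * b + r) = A (p * b).
  by move=> pq; case: (IH p pq) => + _; apply.
have IHB c : B c -> c < q * b -> b %| c.
  move=> Bc cq; have cE := divn_eq c b; have rb := ltn_pmod c b_gt0.
  have pq : c %/ b < q by rewrite ltn_divLR.
  have [_ /(_ (c %% b)) nB] := IH _ pq.
  have [r0|r0] := posnP (c %% b); first by rewrite /dvdn r0.
  by case: nB; rewrite ?r0 // -cE.
have [Nq|qN] := leqP N (q * b).
  have nA r : A (q * b + r) = false.
    by apply/negP => /AB_lt /(_ B0); lia.
  split=> [r _|r _ /(AB_lt A0)]; last by lia.
  by rewrite nA; have := nA 0; rewrite addn0 => ->.
have [Aq|nAq] := boolP (A (q * b)).
  have nB r : 0 < r < b -> ~ B (q * b + r).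
    move=> rb Br.
    have Ar : A (b - r) by apply: interval_sub_left; lia.
    (* (b - r) + (q b + r) = q b + b would be two representations. *)
    have E : q * b + r = b by apply: AB_uniq Ar Br Aq Bb _; lia.
    have [q0|q0] := posnP q; nia.
  split=> // r rb; apply/idP.
  have qbN := AB_lt Aq Bb.
  have [|a [c [Aa Bc ac]]] := @AB_onto (q * b + r); first lia.
  have [c0|c0] := posnP c; first by move: Aa; have -> : a = q * b + r by lia.
  have bc := b_min Bc c0.
  (* As [c <= q * b + r], either [c] precedes the current block and [IHB] applies, or it lies in it
     and [nB] leaves only the starting point. *)
  have db : b %| c.
    have [cq|qc] := ltnP c (q * b); first exact: IHB.
    have [s0|s0] := posnP (c - q * b).
      by rewrite (_ : c = q * b) ?dvdn_mull //; lia.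
    by case: (nB (c - q * b)); [lia | rewrite subnKC].
  case/dvdnP: db => d cE.
  have dq : d <= q by nia.
  have d0 : 0 < d by nia.
  have aE : a = (q - d) * b + r by nia.
  have Ad : A ((q - d) * b) by rewrite -(IHA _ r) -?aE //; lia.
  have : c = 0 by apply: AB_uniq Ad Bc Aq B0 _; nia.
  lia.
have [a [c [Aa Bc ac]]] := AB_onto qN.
have c0 : 0 < c.
  by rewrite lt0n; apply: contraNneq nAq => c0; rewrite -ac c0 addn0.
have db : b %| c.
  have [cq|qc] := ltnP c (q * b); first exact: IHB.
  by rewrite (_ : c = q * b) ?dvdn_mull //; lia.
case/dvdnP: db => d cE.
have dq : d <= q by nia.
have d0 : 0 < d by nia.
have aE : a = (q - d) * b by nia.
have Ar r : r < b -> A (a + r) by move=> rb; rewrite aE IHA -?aE //; lia.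
(* Since [(a + r) + c] represents [q * b + r], uniqueness forces [c = 0] in the first case and
   [c = q * b + r] in the second; both contradict [0 < c <= q * b]. *)
split=> [r rb|r /andP[r0 rb] Br].
  apply/negP => Aqr.
  have := AB_uniq (Ar r rb) Bc Aqr B0; lia.
have := AB_uniq (Ar r rb) Bc A0 Br; lia.
Qed.

Lemma left_blocks y : A y = A (y %/ b * b).
Proof.
rewrite {1}(divn_eq y b); case: (block_structure (y %/ b)) => + _; apply.
exact: ltn_pmod.
Qed.

Lemma right_dvd c : B c -> b %| c.
Proof.
have [_ nB] := block_structure (c %/ b).
move=> Bc; have [//|r0] := posnP (c %% b); first by rewrite /dvdn => ->.
by case: (nB (c %% b)); rewrite ?r0 ?ltn_pmod // -divn_eq.
Qed.

(** Suppose the remainder [r] is positive and write [N - r] as [a + c]. Both terms are multiples of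
    [b], so [a + r] is in the block of [a], hence in [A], and [(a + r) + c = N] is out of bounds. *)
Lemma total_dvd : b %| N.
Proof.
have [r0|r0] := posnP (N %% b); first by rewrite /dvdn r0.
have NE := divn_eq N b; have rb := ltn_pmod N b_gt0.
have [|a [c [Aa Bc ac]]] := @AB_onto (N %/ b * b); first lia.
case/dvdnP: (right_dvd Bc) => d cE.
have aE : a = (N %/ b - d) * b by nia.
have [hA _] := block_structure (N %/ b - d).
have := @AB_lt (a + N %% b) c; rewrite aE hA // -aE => /(_ Aa Bc); lia.
Qed.

End TwoSummands.

(** * Direct sum decompositions with finitely many summands *)

Section SumSystems.

Variable I : finType.
Implicit Types (A : I -> pred nat) (x : I -> nat).

Definition sum_system A (N : nat) : Prop :=
  [/\ forall x, (forall i, A i (x i)) -> \sum_i x i < N,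
      forall v, v < N -> exists2 x, forall i, A i (x i) & \sum_i x i = v
    & forall x x', (forall i, A i (x i)) -> (forall i, A i (x' i)) ->
        \sum_i x i = \sum_i x' i -> x =1 x'].

Lemma sum_system0 A N i : sum_system A N -> 0 < N -> A i 0.
Proof.
case=> _ onto _ /onto[x Ax /eqP]; rewrite sum_nat_eq0 => /forallP/(_ i)/eqP <-.
exact: Ax.
Qed.

(** Reduction to two summands: [A j] against the sumset [B] of all the others. A positive sum has a
    positive term, so [b] is also the least positive element of [B]. *)
Lemma sum_system_peel A N j b : sum_system A N -> 0 < N -> 0 < b ->
    (exists2 i, i != j & A i b) ->
    (forall i c, i != j -> A i c -> 0 < c -> b <= c) ->
  [/\ b %| N, forall y, A j y = A j (y %/ b * b)
    & forall i c, i != j -> A i c -> b %| c].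
Proof.
move=> sysA N0 b0 [i0 ij Ab] bmin.
have A0 i : A i 0 by exact: sum_system0 sysA N0.
case: sysA => lt onto uniq.
pose B c := exists2 x, forall i, A i (x i) & \sum_(i | i != j) x i = c.
have BA i c : i != j -> A i c -> B c.
  move=> ij' Aic; exists (fun k => if k == i then c else 0).
    by move=> k; case: eqP => // ->.
  by rewrite (bigD1 i) //= eqxx big1 ?addn0 // => k /andP[_ /negbTE ->].
have join a c x : (forall i, A i (x i)) -> A j a -> \sum_(i | i != j) x i = c ->
    exists y, [/\ forall i, A i (y i), \sum_i y i = a + c,
                  y j = a & forall i, i != j -> y i = x i].
  move=> Ax Aa xc; exists (fun k => if k == j then a else x k); split.
  - by move=> k; case: eqP => // ->.
  - rewrite (bigD1 j) //= eqxx -xc; congr (_ + _).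
    by apply: eq_bigr => k /negbTE ->.
  - by rewrite eqxx.
  - by move=> k /negbTE ->.
have B0 : B 0 by exists (fun=> 0) => //; rewrite big1.
have Bb : B b := BA _ _ ij Ab.
have ABlt a c : A j a -> B c -> a + c < N.
  move=> Aa [x Ax xc]; have [y [Ay <- _ _]] := join _ _ _ Ax Aa xc.
  exact: lt.
have ABonto v : v < N -> exists a c, [/\ A j a, B c & a + c = v].
  move=> /onto[x Ax xv]; exists (x j), (\sum_(i | i != j) x i).
  by split; [exact: Ax | exists x | rewrite -xv [RHS](bigD1 j)].
have ABuniq a c a' c' :
    A j a -> B c -> A j a' -> B c' -> a + c = a' + c' -> c = c'.
  move=> Aa [x Ax xc] Aa' [x' Ax' xc'].
  have [y [Ay <- yj yE]] := join _ _ _ Ax Aa xc.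
  have [y' [Ay' <- yj' yE']] := join _ _ _ Ax' Aa' xc'.
  move=> /uniq -/(_ Ay Ay') yy; rewrite -xc -xc'.
  by apply: eq_bigr => k kj; rewrite -yE // -yE' // yy.
have Bmin c : B c -> 0 < c -> b <= c.
  case=> x Ax <-; rewrite lt0n sum_nat_eq0 negb_forall => /existsP[k].
  rewrite negb_imply -lt0n => /andP[kj xk].
  by rewrite (bigD1 k) //= (leq_trans (bmin _ _ kj (Ax k) xk)) ?leq_addr.
split.
- exact: (total_dvd (A0 j) B0 ABlt ABonto ABuniq b0 Bb Bmin).
- exact: (left_blocks (A0 j) B0 ABlt ABonto ABuniq b0 Bb Bmin).
- move=> i c ik /(BA _ _ ik).
  exact: (right_dvd (A0 j) B0 ABlt ABonto ABuniq b0 Bb Bmin).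
Qed.

Lemma sum_system_periodic A N : sum_system A N -> 1 < N ->
  exists j P, [/\ 0 < P < N, P %| N
    & forall y, y + P < N -> A j (y + P) = A j y].
Proof.
elim/ltn_ind: N A => N IH A sysA N1.
have N0 : 0 < N by lia.
have A0 i : A i 0 by exact: sum_system0 sysA N0.
have [lt onto uniq] := sysA.
pose at_ i c := fun k : I => if k == i then c else 0.
have at_A i c : A i c -> forall k, A k (at_ i c k).
  by move=> Ac k; rewrite /at_; case: eqP => // ->.
have at_sum i c : \sum_k at_ i c k = c.
  by rewrite (bigD1 i) //= /at_ eqxx big1 ?addn0 // => k /negbTE ->.
have [j A1] : exists j, A j 1.
  have [x Ax x1] := onto 1 N1.
  have: \sum_i x i != 0 by rewrite x1.
  rewrite sum_nat_eq0 negb_forall => /existsP[j]; rewrite implyTb => xj.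
  exists j; have <- : x j = 1; last exact: Ax.
  by move: x1 xj; rewrite (bigD1 j) //=; case: (x j) => [|[|]].
pose Q c := (0 < c) && [exists (i | i != j), A i c].
(* Searching below [N] loses nothing, since every element of every [A i] is less than [N]. *)
have [/existsP exQ|nQ] := boolP [exists c : 'I_N, Q c]; last first.
  (* The other summands contain only 0, so [A j] fills the interval and has period 1. *)
  exists j, 1; split=> //.
  suff Aj y : y < N -> A j y by move=> y yN; rewrite !Aj //; lia.
  move=> /onto[x Ax <-]; rewrite (bigD1 j) //= big1 ?addn0 // => i ij.
  apply/eqP; rewrite -leqn0 leqNgt; apply: contra nQ => xi.
  have xN : x i < N by rewrite -(at_sum i (x i)); apply/lt/at_A.
  apply/existsP; exists (Ordinal xN); rewrite /Q xi.
  by apply/existsP; exists i; rewrite ij Ax.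
have exb : exists c, Q c by case: exQ => c; exists c.
case: (ex_minnP exb) => b /andP[b0 /existsP[i0 /andP[ij Ab]]] bmin.
have bmin' i c : i != j -> A i c -> 0 < c -> b <= c.
  move=> ik Ac c0; apply: bmin; rewrite /Q c0.
  by apply/existsP; exists i; rewrite ik.
(* Otherwise 1 would be represented both through [A j] and through [A i0]. This makes the quotient
   system strictly shorter. *)
have b1 : b != 1.
  apply: contra_neq ij => bE; rewrite bE in Ab.
  have := uniq _ _ (at_A _ _ A1) (at_A _ _ Ab).
  rewrite !at_sum => /(_ erefl i0); rewrite /at_ eqxx.
  by case: eqP.
have bN : b < N by rewrite -(at_sum i0 b); apply/lt/at_A.
have [dN blk dvd] := sum_system_peel sysA N0 b0 (ex_intro2 _ _ i0 ij Ab) bmin'.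
case/dvdnP: dN => N' NE.
pose A' i := [pred y | A i (y * b)].
have sysA' : sum_system A' N'.
  split.
  - move=> x /lt; rewrite -big_distrl /= NE; nia.
  - move=> v vN'; have [|x Ax xv] := onto (v * b); first nia.
    (* Peeling covers every term except the one at [j]; that one follows because the total [v * b]
       is a multiple of [b]. *)
    have xd i : b %| x i.
      have [->|ik] := eqVneq i j; last exact: dvd (Ax i).
      have: b %| \sum_i x i by rewrite xv dvdn_mull.
      rewrite (bigD1 j) //= dvdn_addl //.
      by apply: dvdn_sum => k kj; apply: dvd (Ax k).
    exists (fun i => x i %/ b) => [i|]; first by rewrite /= divnK.
    apply/eqP; rewrite -(eqn_pmul2r b0) big_distrl -xv /=.
    by apply/eqP/eq_bigr => i _; rewrite divnK.
  - move=> x y Ax Ay xy i.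
    have := uniq _ _ Ax Ay; rewrite -!big_distrl /= xy => /(_ erefl i).
    by move/eqP; rewrite eqn_pmul2r // => /eqP.
have [| |k [P [PN' PdN per]]] := IH N' _ A' sysA'; try nia.
exists k, (P * b); split; first nia; first by rewrite NE dvdn_mul.
move=> y yN.
(* The period of the quotient, scaled by [b]. In direction [j] membership depends only on the block;
   in the other directions non-multiples of [b] are never members. *)
have perb : A k ((y + P * b) %/ b * b) = A k (y %/ b * b).
  rewrite divnDMl //; apply: per; have := leq_divM y b; nia.
have [kj|kj] := eqVneq k j; first by rewrite kj blk [RHS]blk -kj.
have [dy|ndy] := boolP (b %| y).
  by move: perb; rewrite !divnK // dvdn_add // dvdn_mull.
rewrite (contraNF (dvd _ _ kj) ndy); apply: contraNF ndy => /(dvd _ _ kj).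
by rewrite dvdn_addl // dvdn_mull.
Qed.
End SumSystems.

(** * Enumeration of a periodic set *)

Lemma filter_iota_periodic (A : pred nat) P t :
    (forall y, y + P < t * P -> A (y + P) = A y) ->
  let T := [seq y <- iota 0 P | A y] in
  let S := [seq y <- iota 0 (t * P) | A y] in
  size S = t * size T /\
  forall q r, q < t -> r < size T ->
    nth 0 S (q * size T + r) = nth 0 T r + q * P.
Proof.
move=> per T; elim: t per => [|t IH] per S //.
have [|szS nthS] := IH; first by move=> y yP; apply: per; rewrite mulSn; lia.
have perA q y : q <= t -> y < P -> A (q * P + y) = A y.
  elim: q => [//|q IHq] qt yP; rewrite -(IHq (ltnW qt) yP).
  by rewrite mulSnr addnAC per //; nia.
(* The last window of length [P] contributes a translate of [T], so adding [P] to a value amounts to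
   adding [size T] to its position. *)
have SE : S = [seq y <- iota 0 (t * P) | A y] ++ [seq t * P + y | y <- T].
  rewrite /S mulSnr iotaD filter_cat add0n; congr (_ ++ _).
  rewrite -[X in iota X]addn0 iotaDl filter_map; congr map.
  by apply: eq_in_filter => z; rewrite mem_iota /= => zP; apply: perA; lia.
rewrite SE size_cat size_map szS mulSnr; split=> // q r qt rT.
rewrite nth_cat szS; have [qt'|tq] := ltnP q t.
  by rewrite ifT ?nthS //; nia.
have -> : q = t by lia.
by rewrite ltnNge leq_addr addKn (nth_map 0) //= addnC.
Qed.

(** * Additive form of a principal reversible cuboid *)

Section Coordinates.

Variables (m : nat) (n : mvec m) (M : cuboid m).
Hypothesis n_gt0 : positive_mvec n.

Lemma in_range_ones : in_range n (ones m).
Proof. by split=> i; rewrite ffunE. Qed.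

Lemma in_range_subst k i a :
  in_range n k -> 0 < a <= n i -> in_range n (subst_coord k i a).
Proof.
case=> k0 kn /andP[a0 an].
by split=> x; rewrite ffunE; case: eqP => [E|_]; rewrite ?E.
Qed.

Lemma subst_coord_id (k : mvec m) i : subst_coord k i (k i) = k.
Proof. by apply/ffunP=> x; rewrite ffunE; case: eqP => [->|]. Qed.

Lemma property_V_neq i j k a c : property_V n M -> i != j -> in_range n k ->
    0 < a <= n i -> 0 < c <= n j ->
  M k + M (subst_coord (subst_coord k i a) j c)
  = M (subst_coord k j c) + M (subst_coord k i a).
Proof.
move=> hV ij kn an cn; case: (ltngtP i j) => [lt|lt|/val_inj eq].
- exact: hV.
- rewrite addnC [RHS]addnC -hV // addnC; congr (_ + M _).
  apply/ffunP=> x; rewrite !ffunE.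
  by case: (eqVneq x j) => [->|//]; rewrite eq_sym (negbTE ij).
- by rewrite eq eqxx in ij.
Qed.

(** The summand [f_i] of the additive form, normalised to vanish at index 1. For indices in range
    the truncated subtraction is exact, because entries of a principal reversible cuboid
    increase. *)
Definition coord_part (i : 'I_m) (a : nat) : nat :=
  M (subst_coord (ones m) i a) - M (ones m).

Hypothesis hM : principal_reversible n M.

Lemma coord_part_shift i a : 0 < a <= n i ->
  M (subst_coord (ones m) i a) = M (ones m) + coord_part i a.
Proof.
move=> an; rewrite subnKC //; have [a1|a1] := leqP a 1.
  rewrite [X in _ <= M X](_ : _ = ones m) //; apply/ffunP=> x; rewrite !ffunE.
  by case: eqP => //; lia.
case: hM => _ _ /(_ (ones m) i (a - 1) in_range_ones).
rewrite ffunE => lt; apply: ltnW.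
rewrite [X in _ <= M X](_ : _ = add_unit (ones m) (a - 1) i).
  by apply: lt; lia.
by apply/ffunP=> x; rewrite !ffunE; case: eqP => //; lia.
Qed.

Lemma coord_part1 i : coord_part i 1 = 0.
Proof.
rewrite /coord_part [X in M X - _](_ : _ = ones m) ?subnn //.
by apply/ffunP=> x; rewrite !ffunE; case: eqP.
Qed.

Lemma coord_part_lt i a c : 0 < a -> a < c <= n i ->
  coord_part i a < coord_part i c.
Proof.
move=> a0 ac; have an : 0 < a <= n i by lia.
have cn : 0 < c <= n i by lia.
rewrite -(ltn_add2l (M (ones m))) -!coord_part_shift //.
case: hM => _ _ /(_ _ i (c - a) (in_range_subst in_range_ones an)).
rewrite ffunE eqxx => lt.
rewrite [X in _ < M X](_ : _ = add_unit (subst_coord (ones m) i a) (c - a) i).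
  by apply: lt; lia.
by apply/ffunP=> x; rewrite !ffunE; case: eqP => //; lia.
Qed.

Lemma sum_coord_subst k i a :
  \sum_x coord_part x (subst_coord k i a x) + coord_part i (k i)
  = \sum_x coord_part x (k x) + coord_part i a.
Proof.
rewrite (bigD1 i) //= [in RHS](bigD1 i) //= ffunE eqxx.
rewrite (eq_bigr (fun x => coord_part x (k x))).
  by rewrite addnAC [RHS]addnAC (addnC (coord_part i a)).
by move=> x /negbTE xi; rewrite ffunE xi.
Qed.

(** Induction on the sum of the coordinates. If two of them differ from 1, property (V) with both
    replaced by 1 expresses [M k] through three smaller index vectors; otherwise [k] lies on an axis
    through [ones m]. *)
Lemma cuboid_sum_ones k : in_range n k ->
  M k = M (ones m) + \sum_i coord_part i (k i).
Proof.
have [d] := ubnP (\sum_i k i); elim: d k => // d IH k kd kn.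
have n1 i : 0 < 1 <= n i by rewrite n_gt0.
have [k0 kle] := kn.
have sub1 i : k i != 1 -> \sum_x (subst_coord k i 1) x < \sum_x k x.
  move=> ki; rewrite (bigD1 i) //= [X in _ < X](bigD1 i) //= ffunE eqxx.
  have -> : \sum_(x | x != i) subst_coord k i 1 x = \sum_(x | x != i) k x.
    by apply: eq_bigr => x /negbTE xi; rewrite ffunE xi.
  by rewrite ltn_add2r; have := k0 i; lia.
have [/existsP[i ki]|] := boolP [exists i, k i != 1]; last first.
  rewrite negb_exists => /forallP k1.
  have -> : k = ones m.
    by apply/ffunP=> x; rewrite ffunE; apply/eqP; rewrite -[_ == _]negbK k1.
  by rewrite big1 ?addn0 // => i _; rewrite ffunE coord_part1.
have [/existsP[j /andP[ji kj]]|] := boolP [exists (j | j != i), k j != 1].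
  have ij : i != j by rewrite eq_sym.
  have hi := in_range_subst kn (n1 i); have hj := in_range_subst kn (n1 j).
  have hij := in_range_subst hi (n1 j).
  case: hM => hV _ _.
  have := property_V_neq hV ij kn (n1 i) (n1 j).
  have li := sub1 i ki; have lj := sub1 j kj.
  have lij : \sum_x (subst_coord (subst_coord k i 1) j 1) x
      <= \sum_x (subst_coord k i 1) x.
    apply: leq_sum => x _; rewrite [X in X <= _]ffunE.
    by case: eqP => // ->; case: hi.
  rewrite (IH _ _ hi) ?(IH _ _ hj) ?(IH _ _ hij); try lia.
  have := sum_coord_subst k i 1; have := sum_coord_subst k j 1.
  have := sum_coord_subst (subst_coord k i 1) j 1.
  rewrite [subst_coord k i 1 j]ffunE (negbTE ji); lia.
rewrite negb_exists => /forallP k1.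
have kE : k = subst_coord (ones m) i (k i).
  apply/ffunP=> x; rewrite !ffunE; case: eqP => [->//|/eqP xi].
  by have := k1 x; rewrite xi /= negbK => /eqP.
rewrite {1}kE coord_part_shift; last by rewrite k0 kle.
congr (_ + _); rewrite (bigD1 i) //= big1 ?addn0 // => x xi.
by have := k1 x; rewrite xi /= negbK => /eqP ->; rewrite coord_part1.
Qed.

Lemma volume_gt0 : 0 < \prod_i n i.
Proof. by apply: prodn_gt0. Qed.

(** The value 0 is attained and has [M (ones m)] as a summand, so that corner entry is 0. *)
Lemma cuboid_sum k : in_range n k -> M k = \sum_i coord_part i (k i).
Proof.
move=> kn; rewrite cuboid_sum_ones //.
case: hM => _ onto _; have [_ /(_ volume_gt0)[k' kn' Mk']] := onto 0.
by move: Mk'; rewrite cuboid_sum_ones //; lia.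
Qed.

(** Pigeonhole: a right inverse [s] of [M] is an injection from [N] values into [N] index vectors,
    hence onto. *)
Lemma cuboid_inj k k' : in_range n k -> in_range n k' -> M k = M k' -> k = k'.
Proof.
have [_ onto _] := hM.
pose D := {dffun forall i : 'I_m, 'I_(n i)}; pose N := \prod_i n i.
pose vec (x : D) : mvec m := [ffun i => (x i).+1].
have vec_onto l : in_range n l -> exists x, vec x = l.
  case=> l0 ln; have lt i : (l i).-1 < n i by rewrite prednK.
  exists [ffun i => Ordinal (lt i)].
  by apply/ffunP=> i; rewrite !ffunE /= prednK.
have cardD : #|D| = N.
  rewrite card_dep_ffun foldrE big_map enumT.
  by apply: eq_bigr => i _; rewrite card_ord.
have /fin_all_exists[s sP] (v : 'I_N) : exists x, M (vec x) = v.
  have [_ /(_ (ltn_ord v))[l ln lv]] := onto v.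
  by have [x xl] := vec_onto l ln; exists x; rewrite xl.
have s_inj : injective s.
  by move=> v w vw; apply: val_inj; rewrite /= -!sP vw.
have s_onto x : x \in codom s.
  by apply: inj_card_onto s_inj _ x; rewrite cardD card_ord.
have vecs l : in_range n l -> exists2 v, l = vec (s v) & M l = val v.
  move=> /vec_onto[x <-]; have /codomP[v ->] := s_onto x.
  by exists v; rewrite ?sP.
move=> /vecs[v -> ->] /vecs[w -> ->] /val_inj vw.
by rewrite vw.
Qed.

(** The set [A_i] as a list; position [a] holds the value at index [a.+1], since indices are
    1-based. *)
Definition coord_values (i : 'I_m) : seq nat :=
  mkseq (fun a => coord_part i a.+1) (n i).

Lemma coord_values_sorted i : sorted ltn (coord_values i).
Proof.
apply/(sortedP 0) => a; rewrite size_mkseq => an.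
rewrite !nth_mkseq //; last by lia.
by apply: coord_part_lt => //; lia.
Qed.

Lemma coord_values_index (x : 'I_m -> nat) :
    (forall i, x i \in coord_values i) ->
  exists2 k, in_range n k & forall i, x i = coord_part i (k i).
Proof.
move=> xA; exists [ffun i => (index (x i) (coord_values i)).+1].
  split=> i; rewrite ffunE //.
  by have := xA i; rewrite -index_mem size_mkseq.
move=> i; rewrite ffunE -[LHS](nth_index 0 (xA i)) nth_mkseq //.
by have := xA i; rewrite -index_mem size_mkseq.
Qed.

Lemma coord_part_mem i a : 0 < a <= n i -> coord_part i a \in coord_values i.
Proof.
case: a => // a an; apply/mapP; exists a => //.
by rewrite mem_iota.
Qed.

Lemma cuboid_sum_system :
  sum_system (fun i => [pred y | y \in coord_values i]) (\prod_i n i).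
Proof.
have [_ onto _] := hM; split.
- move=> x /coord_values_index[k kn xk].
  by apply/onto; exists k; rewrite // cuboid_sum //; apply: eq_bigr.
- move=> v /onto[k kn <-]; exists (fun i => coord_part i (k i)).
    by move=> i /=; apply: coord_part_mem; case: kn => k0 kl; rewrite k0 kl.
  by rewrite cuboid_sum.
- move=> x y /coord_values_index[k kn xk] /coord_values_index[l ln yl].
  rewrite (eq_bigr _ (fun i _ => xk i)) (eq_bigr _ (fun i _ => yl i)).
  by rewrite -!cuboid_sum // => /(cuboid_inj kn ln) kl i; rewrite xk yl kl.
Qed.

Lemma coord_part_bound i a : 0 < a <= n i -> coord_part i a < \prod_x n x.
Proof.
move=> an; have [_ onto _] := hM.
have kn := in_range_subst in_range_ones an.
apply: leq_ltn_trans (_ : _ <= M (subst_coord (ones m) i a)) _.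
  by rewrite leq_subr.
by apply/onto; exists (subst_coord (ones m) i a).
Qed.

(** Puts the list into the form enumerated by [filter_iota_periodic]: two strictly increasing lists
    with the same elements coincide. *)
Lemma coord_values_filter i :
  coord_values i = [seq y <- iota 0 (\prod_x n x) | y \in coord_values i].
Proof.
apply: (irr_sorted_eq ltn_trans ltnn); first exact: coord_values_sorted.
  by apply: sorted_filter (iota_ltn_sorted _ _); exact: ltn_trans.
move=> y; rewrite mem_filter mem_iota /= add0n.
case: mapP => //= -[a]; rewrite mem_iota => an ->.
by rewrite coord_part_bound.
Qed.

End Coordinates.

(** * Truncation in the periodic direction *)

Lemma volume_gt1 m (n : mvec m) :
  positive_mvec n -> n <> ones m -> 1 < \prod_i n i.
Proof.
move=> n0 n1.
have [/existsP[i ni]|] := boolP [exists i, n i != 1]; last first.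
  rewrite negb_exists => /forallP ni; case: n1.
  by apply/ffunP=> i; rewrite ffunE; have := ni i; rewrite negbK => /eqP.
rewrite (bigD1 i) //=; apply: leq_trans (leq_pmulr _ _).
  by have := n0 i; lia.
by apply: prodn_gt0.
Qed.

Theorem theorem7 (m : nat) (n : mvec m) (M : cuboid m)
    (hm : 2 <= m) (hn : positive_mvec n) (hn1 : n <> ones m)
    (hM : principal_reversible n M) :
  exists (j : 'I_m) (nt : mvec m),
    [/\ positive_mvec nt,
        forall i : 'I_m, i != j -> nt i = n i,
        nt j < n j,
        nt j %| n j
      & principal_reversible_subcuboid n M nt] /\
    (forall (nh : mvec m) (k : nat),
        positive_mvec nh -> le_mvec nh nt -> k < n j %/ nt j ->
        M (add_unit nh (k * nt j) j) = M nh + k * \prod_(i < m) nt i).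
Proof.
have [j [P [/andP[P0 PN] /dvdnP[t NE] per]]] :=
  sum_system_periodic (cuboid_sum_system hn hM) (volume_gt1 hn hn1).
have t1 : 1 < t by nia.
rewrite NE in per; have [] := filter_iota_periodic per.
rewrite -NE -(coord_values_filter hn hM) size_mkseq.
(* The truncated dimension [nj] counts the elements of [A_j] below [P]; each of the [t] periods
   contributes as many, so [n j = t * nj]. *)
set T := filter _ _; set nj := size T => njE nthS.
have nj0 : 0 < nj by have := hn j; rewrite njE; lia.
(* Index [a + q * nj] sits at position [q * nj + a.-1] of the list, where [nthS] applies. *)
have shift a q : 0 < a <= nj -> q < t ->
    coord_part M j (a + q * nj) = coord_part M j a + q * P.
  move=> an qt; have at_ p : p < t ->
      coord_part M j (a + p * nj) = nth 0 T a.-1 + p * P.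
    move=> pt; rewrite -nthS //; last lia.
    rewrite nth_mkseq; last by rewrite njE; nia.
    by congr coord_part; lia.
  by rewrite at_ // -[a in RHS]addn0 (at_ 0) //; lia.
pose nt := subst_coord n j nj.
have ntj : nt j = nj by rewrite ffunE eqxx.
have nti i : i != j -> nt i = n i by rewrite ffunE => /negbTE ->.
have nt_gt0 : positive_mvec nt.
  by move=> i; rewrite ffunE; case: eqP.
have nt_le : le_mvec nt n.
  by move=> i; rewrite ffunE; case: eqP => // ->; rewrite njE; nia.
have ntP : \prod_i nt i = P.
  apply/eqP; rewrite -(@eqn_pmul2l t); last lia.
  rewrite -NE (bigD1 j) //= [X in _ == X](bigD1 j) //= ntj njE mulnA.
  by apply/eqP; congr (_ * _); apply: eq_bigr => i /nti.
have wide k : in_range nt k -> in_range n k.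
  by case=> k0 kn; split=> // i; apply: leq_trans (nt_le i).
have in_add k q : in_range nt k -> q < t -> in_range n (add_unit k (q * nj) j).
  move=> knt qt; have [k0 kn] := wide k knt; have [_ /(_ j)] := knt.
  rewrite ntj => kj; split=> i; rewrite ffunE; case: eqP => // ->.
    by rewrite ltn_addr.
  by rewrite njE; nia.
have Mshift k q : in_range nt k -> q < t ->
    M (add_unit k (q * nj) j) = M k + q * P.
  move=> knt qt; rewrite (cuboid_sum hn hM (in_add _ _ knt qt)).
  rewrite (cuboid_sum hn hM (wide _ knt)) (bigD1 j) //= [in RHS](bigD1 j) //=.
  rewrite ffunE eqxx shift //; last first.
    by case: knt => k0 /(_ j); rewrite ntj k0.
  rewrite addnAC; congr (_ + _ + _); apply: eq_bigr => i /negbTE ij.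
  by rewrite ffunE ij.
exists j, nt; split; last first.
  move=> k q k0 kn; rewrite ntj njE mulnK // ntP => qt.
  exact: Mshift.
split=> //; rewrite ?ntj; first by rewrite njE; nia.
  by rewrite njE dvdn_mull.
have [hV onto incr] := hM.
split=> //; split.
- move=> i i' k a c ii' /wide kn an cn.
  by apply: hV => //; [have := nt_le i | have := nt_le i']; lia.
(* An index vector with [k j > nj] has an entry of at least [coord_part M j (1 + nj)], which is
   [P]. *)
- have small v : v < P -> exists2 k, in_range nt k & M k = v.
    move=> vP; have [_ [|k kn Mk]] := onto v; first exact: ltn_trans PN.
    exists k => //; have [k0 kle] := kn; split=> // i.
    have [->|ij] := eqVneq i j; last by rewrite nti.
    rewrite ntj leqNgt; apply/negP => njk.
    have: coord_part M j (k j) <= v.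
      by rewrite -Mk (cuboid_sum hn hM kn) (bigD1 j) //= leq_addr.
    have: coord_part M j (1 + 1 * nj) <= coord_part M j (k j).
      have [->//|ne] := eqVneq (k j) (1 + 1 * nj).
      by apply/ltnW/(coord_part_lt hn hM) => //; have := kle j; lia.
    by rewrite shift //; lia.
  move=> v; rewrite ntP; split=> [[k knt Mk]|]; last exact: small.
  have vN : v < t * P by rewrite -NE; apply/onto; exists k; first exact: wide.
  (* Shifting the position of [v %% P] by [v %/ P] periods also yields [v], so by injectivity it is
     [k]; the bound [k j <= nj] then leaves no room for a positive shift. *)
  have [k' knt' Mk'] := small _ (ltn_pmod v P0).
  have qt : v %/ P < t by rewrite ltn_divLR.
  have: k = add_unit k' (v %/ P * nj) j.
    apply: (cuboid_inj hM (wide _ knt) (in_add _ _ knt' qt)).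
    by rewrite Mshift // Mk Mk' addnC -divn_eq.
  move/ffunP/(_ j); rewrite ffunE eqxx => kj.
  case: knt => _ /(_ j); rewrite ntj => kjn; case: knt' => /(_ j) kj0 _.
  have q0 : v %/ P = 0.
    have [//|q1] := posnP (v %/ P).
    by move: kjn; rewrite kj leqNgt -addn1 addnC leq_add // leq_pmull.
  by rewrite (divn_eq v P) q0 ltn_pmod.
- move=> k i l knt hl; apply: incr; first exact: wide.
  by have := nt_le i; lia.
Qed.
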